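(* If a graph $G$ is a clique-sum of graphs $A$ and $B$, then $\gamma(G)=\max\{\gamma(A),\gamma(B)\}$, where $\gamma$ denotes the homological dimension.
   Context: All graphs are finite, simple and undirected, with at least one vertex. Clique-sum: let $G$ be a graph on vertex set $V$ and let $V_1,V_2\subset V$ with $V_1\cup V_2=V$ and $V_1\cap V_2\neq\emptyset$. If the induced subgraph $G[V_1\cap V_2]$ is a clique (complete subgraph) and no edge of $G$ connects a vertex in $V_1\setminus V_2$ to a vertex in $V_2\setminus V_1$, then $G$ is called a clique-sum of the graphs $G[V_1]$ and $G[V_2]$. (No edges of the clique are deleted.) Nerve: for a family of non-empty sets $\mathcal{F}=\{S_1,\dots,S_n\}$ the nerve is the simplicial complex $N(\mathcal{F})=\{\sigma\subset[n] : \bigcap_{i\in\sigma}S_i\neq\emptyset\}$ on the vertex set $[n]=\{1,\dots,n\}$. (Families are indexed; repeated members are allowed.) Connected cover: a connected cover in $G$ is a finite family $\mathcal{F}=\{G_1,\dots,G_n\}$ of (non-empty) induced subgraphs of $G$ such that $G_\sigma=\bigcap_{i\in\sigma}G_i$ is connected for every non-empty $\sigma\in N(\mathcal{F})$; the intersection of induced subgraphs is the subgraph induced by the intersection of their vertex sets, and the nerve is taken with respect to vertex sets. Homology: $\tilde H_i(K)$ is the $i$-th reduced homology group of a simplicial complex $K$ with coefficients in $\mathbb{Z}_2$. Homological dimension: $\gamma(G)$ is the greatest integer $d$ such that $\tilde H_d(N(\mathcal{F}))\neq 0$ for some connected cover $\mathcal{F}$ in $G$; for the one-vertex graph $K_1$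 one sets $\gamma(K_1)=-1$. *)

(* Defs.v *)
From HB Require Import structures.
From mathcomp Require Import all_boot all_order all_algebra.
From mathcomp Require Import generic_quotient ring_quotient.
From mathcomp Require Import boolp.
From mathcomp Require classical_sets.

Set Implicit Arguments.
Unset Strict Implicit.
Unset Printing Implicit Defensive.

Import Order.TTheory GRing.Theory Num.Theory.
Local Open Scope ring_scope.
Local Open Scope quotient_scope.

Record sgraph := SGraph {
  vert :> finType;
  adj : rel vert;
  adj_sym : symmetric adj;
  adj_irrefl : irreflexive adj }.

Section Induced.
Variables (G : sgraph) (S : {set G}).
Definition induced_adj : rel {x : G | x \in S} := fun x y => adj (val x) (val y).
Fact induced_sym : symmetric induced_adj.
Proof. by move=> x y; exact: adj_sym. Qed.
Fact induced_irrefl : irreflexive induced_adj.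
Proof. by move=> x; exact: adj_irrefl. Qed.
Definition induced : sgraph := SGraph induced_sym induced_irrefl.
End Induced.

Definition connected (G : sgraph) : Prop :=
  (0 < #|G|)%N /\ forall x y : G, connect (@adj G) x y.

Definition complete (G : sgraph) : Prop := forall x y : G, x != y -> adj x y.

Definition clique_sum (G : sgraph) (V1 V2 : {set G}) : Prop :=
  [/\ V1 :|: V2 = [set: G],
      V1 :&: V2 != set0,
      complete (induced (V1 :&: V2)) &
      forall x y : G, x \in V1 :\: V2 -> y \in V2 :\: V1 -> ~~ adj x y].

Section Homology.
Variables (I : finType) (K : {set {set I}}).

(* K is a complex given by its faces, the empty face included, so that the
   homology below is reduced. Chains live in the fixed ambient space of all
   'F_2-valued functions on subsets of I; chains d is the subspace spanned by
   the d-dimensional faces (d + 1 vertices; d = -1 for the empty face).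
   The parentheses in ('F_2)^o are needed: 'F_2^o parses as 'F_(2^o). *)
Local Notation chain := {ffun {set I} -> ('F_2)^o}.

Definition simplex (s : {set I}) : chain := [ffun t => (t == s)%:R].

Definition bd_fun (c : chain) : chain :=
  \sum_(s : {set I}) c s *: \sum_(v in s) simplex (s :\ v).

Fact bd_fun_linear : linear bd_fun.
Proof.
move=> a c c'; rewrite /bd_fun scaler_sumr -big_split; apply: eq_bigr => s _.
by rewrite /= !ffunE scalerDl scalerA.
Qed.
HB.instance Definition _ :=
  GRing.isLinear.Build 'F_2 chain chain *:%R bd_fun bd_fun_linear.

Definition bd : 'End(chain) := linfun bd_fun.

Definition chains (d : int) : {vspace chain} :=
  (\sum_(s in K | #|s|%:Z == (d + 1)%R) <[simplex s]>)%VS.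

Definition cycles (d : int) : {vspace chain} := (chains d :&: lker bd)%VS.

Definition boundaries (d : int) : {vspace chain} := (bd @: chains (d + 1)%R)%VS.

(* The boundaries, as a subgroup of the group of cycles. *)
Definition bounding (d : int) : {pred subvs_of (cycles d)} :=
  [pred z | vsval z \in boundaries d].
Arguments bounding d : clear implicits.

Fact bounding_closed d : zmod_closed (bounding d).
Proof.
split; first by rewrite inE linear0 mem0v.
by move=> x y; rewrite !inE => xB yB; rewrite linearB rpredB.
Qed.
HB.instance Definition _ d :=
  GRing.isZmodClosed.Build (subvs_of (cycles d)) (bounding d) (bounding_closed d).

Lemma chain_scaleE a (c : chain) t : (a *: c) t = a * c t.
Proof. by rewrite ffunE. Qed.

Lemma bdE c t : bd c t = \sum_(v | v \notin t) c (v |: t).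
Proof.
rewrite lfunE /= /bd_fun sum_ffunE.
transitivity (\sum_(s : {set I}) \sum_(v in s)
                c s * ((s == v |: t) && (v \notin t))%:R : 'F_2).
  apply: eq_bigr => s _; rewrite chain_scaleE sum_ffunE mulr_sumr.
  apply: eq_bigr => v vs; rewrite ffunE; congr (_ * (nat_of_bool _)%:R).
  apply/eqP/andP=> [->|[/eqP -> vt]]; last by rewrite setU1K.
  by split; rewrite ?setD1K // !inE eqxx.
under [LHS]eq_bigr do rewrite big_mkcond.
rewrite exchange_big /= [RHS]big_mkcond; apply: eq_bigr => v _.
rewrite (bigD1 (v |: t)) //= setU11 eqxx big1 ?addr0 => [|s /negPf ->].
  by case: ifP; rewrite /= ?mulr0 ?mulr1.
by rewrite mulr0; case: ifP.
Qed.

Lemma bd_bd c : bd (bd c) = 0.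
Proof.
apply/ffunP=> t; rewrite bdE ffunE.
under eq_bigr do rewrite bdE big_mkcond.
rewrite big_mkcond.
pose f v w := if [&& v \notin t, w \notin t & v != w] then c (w |: (v |: t)) else 0.
rewrite (eq_bigr (fun v => \sum_w f v w)) => [|v _]; last first.
  rewrite /f; case: (boolP (v \in t)) => //= vt; first by rewrite big1.
  apply: eq_bigr => w _; rewrite in_setU1 negb_or (eq_sym w) andbC.
  by case: (w \notin t) => /=; case: (v == w).
have fC v w : f v w = f w v.
  by rewrite /f setUCA (eq_sym v) andbCA.
have F2 (x : ('F_2)^o) : x + x = 0 by apply/val_inj; case: x => [[|[|]]].
rewrite pair_big /= (bigID (fun p => enum_rank p.1 < enum_rank p.2)%N) /=.
rewrite [X in _ + X](reindex (fun p : I * I => (p.2, p.1))) /=; last first.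
  by exists (fun p : I * I => (p.2, p.1)) => -[].
rewrite -[RHS](F2 (\sum_(p | (enum_rank p.1 < enum_rank p.2)%N) f p.1 p.2)).
congr (_ + _); rewrite big_mkcond [RHS]big_mkcond; apply: eq_bigr => -[v w] _ /=.
rewrite fC -leqNgt leq_eqVlt; case: ltnP => /=; rewrite ?orbT //.
rewrite orbF; case: eqP => // /val_inj/enum_rank_inj -> _.
by rewrite /f eqxx !andbF.
Qed.

Lemma chainsP d (c : chain) :
  reflect (forall s, c s != 0 -> (s \in K) && (#|s|%:Z == d + 1)) (c \in chains d).
Proof.
apply: (iffP idP) => [/memv_sumP [a aP ->] s|cP].
  apply: contraNT => sK; rewrite sum_ffunE big1 // => u uK.
  have /vlineP [k ->] := aP _ uK; rewrite chain_scaleE ffunE.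
  case: eqP => [su|_]; last by rewrite mulr0.
  by rewrite su uK in sK.
have -> : c = \sum_(s in K | #|s|%:Z == d + 1) c s *: simplex s.
  apply/ffunP=> t; rewrite sum_ffunE.
  case: (boolP ((t \in K) && (#|t|%:Z == d + 1))) => tK.
    rewrite (bigD1 t) //= chain_scaleE ffunE eqxx mulr1 big1 ?addr0 //.
    move=> s /andP [_ st].
    by rewrite chain_scaleE ffunE eq_sym (negPf st) mulr0.
  rewrite big1 => [|s sK]; first by apply: contraNeq tK => /cP.
  rewrite chain_scaleE ffunE; case: eqP => [ts|_]; last by rewrite mulr0.
  by rewrite ts sK in tK.
by apply/memv_sumP; exists (fun s => c s *: simplex s) => // s _; rewrite memvZ ?memv_line.
Qed.

Definition homology (d : int) : zmodType := Quotient.quot (bounding d).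

Definition homology_nonzero (d : int) : Prop := exists z : homology d, z != 0.

Lemma homology_nonzeroE d :
  homology_nonzero d <-> exists2 z, z \in cycles d & z \notin boundaries d.
Proof.
rewrite /homology_nonzero; split=> [[z]|[z zZ zB]].
  elim/quotW: z => z z0; exists (vsval z); first exact: subvsP.
  apply: contra z0 => zB; rewrite -(@pi_zeror _ _ _ _ _ (Quotient.quot (bounding d))).
  by rewrite -Quotient.idealrBE subr0.
exists (\pi_(Quotient.quot (bounding d)) (Subvs zZ)).
rewrite -(@pi_zeror _ _ _ _ _ (Quotient.quot (bounding d))).
by rewrite -Quotient.idealrBE subr0.
Qed.
End Homology.

(* The intersection over the empty set of indices is the whole of T, so the
   empty face belongs to the nerve whenever T is non-empty. *)
Definition nerve (T I : finType) (F : I -> {set T}) : {set {set I}} :=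
  [set s : {set I} | \bigcap_(i in s) F i != set0].

Section NerveHomology.
Variables (T I : finType) (F : I -> {set T}).
Local Notation chain := {ffun {set I} -> ('F_2)^o}.

Lemma nerveS (s t : {set I}) : s \subset t -> t \in nerve F -> s \in nerve F.
Proof.
rewrite !inE => st; case/set0Pn=> x /bigcapP xt; apply/set0Pn; exists x.
by apply/bigcapP=> i /(subsetP st)/xt.
Qed.

Lemma nerve_dup (i j : I) (s : {set I}) :
  F i = F j -> j \in s -> s \in nerve F -> i |: s \in nerve F.
Proof.
rewrite !inE => Fij js; case/set0Pn=> x /bigcapP xs; apply/set0Pn; exists x.
by apply/bigcapP=> k /setU1P [->|/xs //]; rewrite Fij xs.
Qed.

Lemma bd_chains d (c : chain) :
  c \in chains (nerve F) (d + 1) -> bd I c \in chains (nerve F) d.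
Proof.
move=> /chainsP cP; apply/chainsP=> t; rewrite bdE.
apply: contraNT => tK; rewrite big1 // => v vt; apply: contraNeq tK.
case/cP/andP=> /(nerveS (subsetUr _ _)) -> /=.
by rewrite cardsU1 vt PoszD addrC => /eqP/addIr ->.
Qed.

Lemma cycle_boundary_of_dup d (S : {set I}) (z : chain) :
  (2 ^ #|T|)%:Z < d + 1 -> z \in cycles (nerve F) d ->
  (forall s, z s != 0 -> s \subset S) -> z \in boundaries (nerve F) d.
Proof.
move=> dT; have [m] := ubnP #|S|; elim: m S z => // m IH S z.
rewrite ltnS => Sm; rewrite memv_cap memv_ker => /andP [zC /eqP z0] zS.
have F2 (x : ('F_2)^o) : x + x = 0 by apply/val_inj; case: x => [[|[|]]].
have [/dinjectiveP/leq_card_in FS|] := boolP (dinjectiveb F S).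
  suff -> : z = 0 by rewrite mem0v.
  apply/ffunP=> s; rewrite ffunE; apply/eqP; apply: contraLR dT => zs.
  have /andP [_ /eqP <-] := chainsP _ _ _ zC _ zs.
  rewrite -leNgt lez_nat (leq_trans (subset_leq_card (zS _ zs))) //.
  by rewrite (leq_trans FS) // -cardsT -powersetT card_powerset cardsT.
case/dinjectivePn => j jS [i /andP [ij iS] Fij].
pose h : chain := [ffun s : {set I} => if (i \in s) && (j \in s) then z (s :\ i) else 0].
have hC : h \in chains (nerve F) (d + 1).
  apply/chainsP=> s; rewrite ffunE; case: ifP; last by rewrite eqxx.
  case/andP=> si sj /(chainsP _ _ _ zC)/andP [sK /eqP sd].
  rewrite -(setD1K si) (nerve_dup (esym Fij)) //=; last by rewrite !inE eq_sym ij.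
  by rewrite cardsU1 !inE eqxx PoszD sd addrC.
have hB : bd I h \in boundaries (nerve F) d by exact: memv_img.
rewrite -[z](subrK (bd I h)) rpredD //.
apply: (IH (S :\ j)).
- by rewrite (leq_trans _ Sm) // [in ltnRHS](cardsD1 j) jS.
- rewrite memv_cap rpredB ?bd_chains //= memv_ker linearB /= bd_bd z0.
  by rewrite subr0.
have zE (t : {set I}) : j \in t -> (z - bd I h) t = 0.
  move=> jt; rewrite !ffunE bdE.
  apply/eqP; rewrite subr_eq0; apply/eqP.
  have [it|it] := boolP (i \in t); last first.
    rewrite (bigD1 i) //= big1 => [|v /andP [_ vi]].
      by rewrite ffunE setU11 in_setU1 jt orbT addr0 setU1K.
    by rewrite ffunE !in_setU1 (negPf it) eq_sym (negPf vi).
  have := congr1 (fun c : chain => c (t :\ i)) z0; rewrite bdE ffunE.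
  rewrite (bigD1 i) ?setD11 //= setD1K // => /(congr1 (+%R (z t))).
  rewrite addrA F2 add0r addr0 => <-.
  apply: eq_big => [v|v]; first by
    rewrite !inE; have [->|] := eqVneq v i; rewrite ?it ?andbF ?andbT.
  rewrite !inE; case/andP=> vt vi; rewrite ffunE !in_setU1 it jt !orbT.
  congr (z _); apply/setP=> w; rewrite !inE.
  by have [->|] := eqVneq w v; rewrite ?vi.
move=> s; apply: contraNT; rewrite subsetD1 negb_and negbK => /orP [sS|js].
  rewrite !ffunE bdE big1 => [|v vs]; last first.
    apply: contraNeq sS; rewrite ffunE; case: ifP; last by rewrite eqxx.
    case/andP=> iv jv /zS vS; apply/subsetP=> w ws; have [->//|wi] := eqVneq w i.
    by apply: (subsetP vS); rewrite !inE wi ws orbT.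
  by rewrite subr0; apply: contraNT sS => /zS.
by rewrite zE // eqxx.
Qed.

End NerveHomology.

Section HomologicalDimension.
Variable G : sgraph.

(* An induced subgraph is identified with its vertex set. *)
Definition connected_cover n (F : 'I_n -> {set G}) : Prop :=
  (forall i, F i != set0) /\
  forall s : {set 'I_n}, s != set0 -> s \in nerve F ->
    connected (induced (\bigcap_(i in s) F i)).

Definition cover_homology (d : int) : Prop :=
  exists n (F : 'I_n -> {set G}),
    connected_cover F /\ homology_nonzero (nerve F) d.

Definition greatest_cover_homology (d : int) : Prop :=
  cover_homology d /\ forall d' : int, cover_homology d' -> d' <= d.

(* hdimP shows that the default value of xget is not used if 1 < #|G|. *)
Definition hdim : int :=
  if #|G| == 1%N then -1 else classical_sets.xget (-1) greatest_cover_homology.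

Lemma cover_homology_le d : cover_homology d -> d + 1 <= (2 ^ #|G|)%:Z.
Proof.
case=> n [F [_ /homology_nonzeroE [z zZ]]]; apply: contraNT; rewrite -ltNge => dG.
by apply: (cycle_boundary_of_dup (S := setT)) => // s _; exact: subsetT.
Qed.

Lemma cover_homologyN1 : (0 < #|G|)%N -> cover_homology (-1).
Proof.
case/card_gt0P=> x _; exists 0%N, (fun=> set0); split.
  by split=> [[]//|s /set0Pn [[]]].
apply/homology_nonzeroE.
have s0 (s : {set 'I_0}) : s = set0 by apply/setP => -[].
exists (simplex set0).
  rewrite memv_cap memv_ker; apply/andP; split.
    apply/chainsP=> s _; rewrite (s0 s) cards0 subrr eqxx andbT inE.
    by apply/set0Pn; exists x; apply/bigcapP=> -[].
  by apply/eqP/ffunP=> t; rewrite bdE ffunE big1 // => -[].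
apply/memv_imgP => -[c /chainsP cP] /ffunP/(_ set0); rewrite bdE ffunE eqxx.
by rewrite big1 // => -[].
Qed.

Lemma hdimP : (1 < #|G|)%N -> greatest_cover_homology hdim.
Proof.
move=> G1; rewrite /hdim eqn_leq leqNgt G1 /=; apply: classical_sets.xgetPex.
pose P (k : nat) := `[< cover_homology (k%:Z - 1) >].
have exP : exists k, P k.
  by exists 0%N; apply/asboolP; apply: cover_homologyN1; exact: ltnW.
have ubP k : P k -> (k <= 2 ^ #|G|)%N.
  by move/asboolP/cover_homology_le; rewrite subrK lez_nat.
case: (ex_maxnP exP ubP) => k /asboolP kP kmax.
exists (k%:Z - 1); split=> // d dP.
rewrite lerBrDr; case E: (d + 1) => [m|m]; last by [].
by rewrite lez_nat kmax //; apply/asboolP; rewrite -E addrK.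
Qed.

End HomologicalDimension.

(* Main.v *)
Require Import Defs.
From mathcomp Require Import all_boot all_order all_algebra.
From mathcomp Require Import boolp.

Set Implicit Arguments.
Unset Strict Implicit.
Unset Printing Implicit Defensive.

Import Order.TTheory GRing.Theory Num.Theory.
Local Open Scope ring_scope.

(** Let [C] be the clique [V1 :&: V2]. It is shown that a non-zero homology
    class in degree [d] of the nerve of a connected cover exists in [G] if and
    only if one exists in [induced V1] or in [induced V2]. One direction is
    clear, since a connected cover of an induced subgraph is a connected cover
    in [G].

    Conversely, let [F] be a connected cover in [G]. A connected set that meets
    both sides meets [C], and its trace on one side stays connected, since an
    excursion to the other side leaves and re-enters through the clique
    ([connected_meets_clique], [connected_restrict]). So the traces of [F] on
    [V1] and on [V2] are connected covers, up to empty members. Their nerves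
    [K1] and [K2] cover the nerve of [F], and [K1 :&: K2] is the nerve of the
    traces on [C]. By Mayer-Vietoris ([homology_union]), either [K1] or [K2] has
    homology in degree [d], or some [d]-chain [a] of [K1] has a boundary that is
    a chain, but not a boundary, of [K1 :&: K2]. In the latter case, adjoin [C]
    as one more member to the traces on [V1]: this is still a connected cover,
    because every non-empty subset of a clique is connected, and its nerve is
    [K1] with a cone over [K1 :&: K2] attached. Closing [a] by the cone over
    its boundary gives a cycle that does not bound ([homology_cone]), so
    [induced V1] has a cover with homology in degree [d].

    The value assigned to one-vertex graphs only requires a separate argument
    when one side is a single vertex; the other side is then all of [G]. *)

(** * Connected vertex sets *)

(** [Y] contains every neighbour in [X] of its members: a union of connected
    components of the graph induced on [X], when [Y] is a subset of [X]. *)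
Definition closed_in (G : sgraph) (X Y : {set G}) : Prop :=
  forall a b : G, a \in Y -> b \in X -> adj a b -> b \in Y.

Lemma connected_inducedP (G : sgraph) (X : {set G}) :
  connected (induced X) <->
  X != set0 /\
  forall Y : {set G}, Y \subset X -> Y != set0 -> closed_in X Y -> Y = X.
Proof.
split=> [[X0 cX]|[X0 cX]].
  split=> [|Y YX /set0Pn [a aY] clY].
    by case/card_gt0P: X0 => x _; apply/set0Pn; exists (val x); exact: valP.
  apply/eqP; rewrite eqEsubset YX; apply/subsetP=> b bX.
  have aX := subsetP YX a aY.
  have clI : closed (@adj (induced X)) [pred x : induced X | val x \in Y].
    apply: intro_closed => [|x y xy xY]; first exact: sym_connect_sym (@adj_sym _).
    by apply: clY xY (valP y) xy.
  have /(closed_connect clI) := cX (exist _ a aX) (exist _ b bX).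
  by rewrite !inE /= aY.
split=> [|x y].
  by case/set0Pn: X0 => x xX; apply/card_gt0P; exists (exist _ x xX).
pose Y := [set val y | y in connect (@adj (induced X)) x].
have YX : Y = X.
  apply: cX.
  - by apply/subsetP=> _ /imsetP [u _ ->]; exact: valP.
  - by apply/set0Pn; exists (val x); apply: imset_f; exact: connect0.
  move=> _ b /imsetP [u xu ->] bX ub; apply/imsetP; exists (exist _ b bX) => //.
  by apply: connect_trans xu (connect1 _).
have: val y \in Y by rewrite YX; exact: valP.
by case/imsetP=> u xu /val_inj ->.
Qed.

(** An induced subgraph of [induced S] is the one induced from [G]; the carriers
    are different types, so connectedness has to be transferred. *)
Lemma connected_preim_val (G : sgraph) (S Y : {set G}) :
  Y \subset S ->
  connected (induced Y) <->
  connected (induced (val @^-1: Y : {set induced S})).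
Proof.
move=> YS; split=> /connected_inducedP [Y0 cY]; apply/connected_inducedP; split.
- case/set0Pn: Y0 => y yY; apply/set0Pn.
  by exists (exist _ y (subsetP YS y yY)); rewrite inE.
- move=> Z ZY /set0Pn [z zZ] clZ.
  suff ZE : val @: Z = Y.
    by rewrite -ZE; apply/setP=> w; rewrite inE (mem_imset _ _ val_inj).
  apply: cY.
  + by apply/subsetP=> _ /imsetP [w /(subsetP ZY) wY ->]; rewrite inE in wY.
  + by apply/set0Pn; exists (val z); exact: imset_f.
  move=> _ b /imsetP [w wZ ->] bY wb.
  apply/imsetP; exists (exist _ b (subsetP YS b bY)) => //.
  by apply: (clZ w (exist _ b (subsetP YS b bY)) wZ _ wb); rewrite inE.
- by case/set0Pn: Y0 => y; rewrite inE => yY; apply/set0Pn; exists (val y).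
move=> Z ZY /set0Pn [z zZ] clZ.
have ZS := subset_trans ZY YS.
have ZE : val @^-1: Z = val @^-1: Y :> {set induced S}.
  apply: cY.
  - by apply/subsetP=> w; rewrite !inE; apply: (subsetP ZY).
  - by apply/set0Pn; exists (exist _ z (subsetP ZS z zZ)); rewrite inE.
  by move=> a b; rewrite !inE; exact: clZ.
apply/eqP; rewrite eqEsubset ZY; apply/subsetP=> y yY.
by have /setP/(_ (exist _ y (subsetP YS y yY))) := ZE; rewrite !inE /= yY.
Qed.

Section CliqueSum.
Variables (G : sgraph) (V1 V2 : {set G}).
Hypothesis VG : clique_sum V1 V2.

Lemma clique_sumC : clique_sum V2 V1.
Proof.
case: VG => VU V0 VC VE; split; rewrite 1?setUC 1?setIC //.
by move=> x y xV yV; rewrite adj_sym VE.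
Qed.

Lemma clique_sum_mem x : (x \in V1) || (x \in V2).
Proof. by case: VG => VU _ _ _; rewrite -in_setU VU inE. Qed.

Lemma clique_sum_adj x y : x \in V1 :&: V2 -> y \in V1 :&: V2 -> x != y -> adj x y.
Proof.
case: VG => _ _ VC _ xC yC xy.
exact: (VC (exist _ x xC) (exist _ y yC)).
Qed.

Lemma clique_sum_sep x y : x \in V1 -> y \in V2 -> adj x y ->
  (x \in V2) || (y \in V1).
Proof.
case: VG => _ _ _ VE xV yV; apply: contraLR; rewrite negb_or => /andP [xV2 yV1].
by apply: VE; rewrite !inE ?xV2 ?yV1.
Qed.

Lemma connected_subclique (X : {set G}) :
  X != set0 -> X \subset V1 :&: V2 -> connected (induced X).
Proof.
move=> X0 XC; apply/connected_inducedP; split=> // Y YX /set0Pn [a aY] clY.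
apply/eqP; rewrite eqEsubset YX; apply/subsetP=> b bX.
have [<- //|ab] := eqVneq a b.
apply: (clY a b) => //; apply: clique_sum_adj => //; apply: (subsetP XC) => //.
exact: (subsetP YX).
Qed.

(** Otherwise the part of [X] in [V1] would be closed in [X]. *)
Lemma connected_meets_clique (X : {set G}) : connected (induced X) ->
  X :&: V1 != set0 -> X :&: V2 != set0 -> X :&: (V1 :&: V2) != set0.
Proof.
case/connected_inducedP=> _ cX X1 /set0Pn [x /setIP [xX x2]].
apply/negP=> /eqP/setP XC.
have XV : X :&: V1 = X.
  apply: cX => // [|a b]; first exact: subsetIl.
  rewrite !inE => /andP [aX a1] bX ab; rewrite bX /=.
  have := XC a; rewrite !inE aX a1 /= => a2.
  have /orP [//|b2] := clique_sum_mem b.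
  by have := clique_sum_sep a1 b2 ab; rewrite a2.
by have := XC x; rewrite -XV !inE xX x2 /=; move: xX; rewrite -XV inE => /andP [_ ->].
Qed.

(** If a closed part [Y] of [X :&: V1] misses [V2], then it is closed in [X]. If
    it meets [V2], then it contains the whole of [X :&: V1 :&: V2], and adding
    [X :&: V2] to it gives a closed part of [X]. *)
Lemma connected_restrict (X : {set G}) : connected (induced X) ->
  X :&: V1 != set0 -> connected (induced (X :&: V1)).
Proof.
case/connected_inducedP=> _ cX X1; apply/connected_inducedP; split=> // Y YX Y0 clY.
have YP a : a \in Y -> (a \in X) && (a \in V1).
  by move/(subsetP YX); rewrite inE.
have [YC|/set0Pn [c /setIP [cY c2]]] := eqVneq (Y :&: V2) set0.
  have YE : Y = X.
    apply: cX => // [|a b aY bX ab]; first by apply: subset_trans YX (subsetIl _ _).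
    have /andP [aX a1] := YP _ aY.
    apply: (clY a b) => //; rewrite inE bX /=.
    have /orP [//|b2] := clique_sum_mem b.
    have /setP/(_ a) := YC; rewrite !inE aY /= => a2.
    by have := clique_sum_sep a1 b2 ab; rewrite a2.
  by rewrite YE; apply/esym/setIidPl; rewrite -{1}YE; apply: subset_trans YX (subsetIr _ _).
have /andP [cX' c1] := YP _ cY.
have CY b : b \in X -> b \in V1 -> b \in V2 -> b \in Y.
  move=> bX b1 b2; have [<- //|cb] := eqVneq c b.
  by apply: (clY c b) => //; rewrite ?inE ?bX //; apply: clique_sum_adj => //; rewrite ?inE ?c1 ?b1.
have YE : Y :|: X :&: V2 = X.
  apply: cX => [||a b aY bX ab].
  - by rewrite subUset subsetIl andbT; apply: subset_trans YX (subsetIl _ _).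
  - by apply/set0Pn; exists c; rewrite inE cY.
  rewrite !inE bX /=; have [b2|b2] := boolP (b \in V2); rewrite ?orbT // orbF.
  have b1 : b \in V1 by have := clique_sum_mem b; rewrite (negPf b2) orbF.
  apply: (clY a b) => //; last by rewrite inE bX.
  case/setUP: aY => // /setIP [aX a2]; apply: CY => //.
  by rewrite adj_sym in ab; have := clique_sum_sep b1 a2 ab; rewrite (negPf b2).
apply/eqP; rewrite eqEsubset YX; apply/subsetP=> b /setIP [bX b1].
by move: (bX); rewrite -YE !inE => /orP [//|/andP [_ b2]]; exact: CY.
Qed.

End CliqueSum.

(** * Chains *)

Local Notation chain I := {ffun {set I} -> ('F_2)^o}.

Lemma addF2 (x : ('F_2)^o) : x + x = 0.
Proof. by apply/val_inj; case: x => [[|[|]]]. Qed.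

Lemma cyclesP (I : finType) (K : {set {set I}}) d (z : chain I) :
  reflect (z \in chains K d /\ bd I z = 0) (z \in cycles K d).
Proof.
rewrite memv_cap memv_ker.
by apply: (iffP andP) => -[zC z0]; split=> //; apply/eqP.
Qed.

Lemma boundariesP (I : finType) (K : {set {set I}}) d (z : chain I) :
  reflect (exists2 u, u \in chains K (d + 1) & z = bd I u) (z \in boundaries K d).
Proof. exact: memv_imgP. Qed.

Lemma chainsS (I : finType) (K L : {set {set I}}) d :
  K \subset L -> (chains K d <= chains L d)%VS.
Proof.
move=> KL; apply/subvP=> c /chainsP cK; apply/chainsP=> s /cK /andP [sK ->].
by rewrite (subsetP KL).
Qed.

Lemma boundariesS (I : finType) (K L : {set {set I}}) d :
  K \subset L -> (boundaries K d <= boundaries L d)%VS.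
Proof. by move=> KL; apply/limgS/chainsS. Qed.

(** The condition on [codom f] says that the points outside the range of [f] are
    not vertices of [K], so [K] is isomorphic to its pullback along [f]. *)
Lemma homology_reindex (I J : finType) (f : J -> I) (K : {set {set I}}) d :
  injective f -> (forall s i, s \in K -> i \in s -> i \in codom f) ->
  homology_nonzero K d -> homology_nonzero [set s : {set J} | f @: s \in K] d.
Proof.
move=> f_inj Kf /homology_nonzeroE [z /cyclesP [zC z0] zB].
apply/homology_nonzeroE.
have fK (s : {set J}) : f @^-1: (f @: s) = s.
  by apply/setP=> j; rewrite inE (mem_imset _ _ f_inj).
have fsub (s : {set I}) : (forall i, i \in s -> i \in codom f) -> f @: (f @^-1: s) = s.
  move=> sf; apply/setP=> i; apply/imsetP/idP => [[j]|is_]; first by rewrite inE => ? ->.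
  by have /codomP [j ij] := sf i is_; exists j; rewrite // inE -ij.
have bd_f (c : chain I) (c' : chain J) t :
    (forall s, c' s = c (f @: s)) -> (forall s, c s != 0 -> forall i, i \in s -> i \in codom f) ->
    bd J c' t = bd I c (f @: t).
  move=> c'E cf; rewrite !bdE.
  rewrite [RHS](bigID (fun i => i \in codom f)) /= [X in _ = _ + X]big1 ?addr0; last first.
    move=> i /andP [_ fi]; apply: contraNeq fi => /cf; apply; exact: setU11.
  rewrite (reindex_omap f (fun i => [pick j | f j == i])) /=; last first.
    move=> i /andP [_ /codomP [j ->]]; case: pickP => [k /eqP <- //|/(_ j)].
    by rewrite eqxx.
  apply: eq_big => [j|j _]; last by rewrite c'E imsetU1.
  rewrite (mem_imset _ _ f_inj) codom_f andbT.
  case: pickP => [k /eqP /f_inj ->|/(_ j)]; last by rewrite eqxx.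
  by rewrite eqxx andbT.
have card_f (s : {set J}) : #|f @: s| = #|s| by rewrite card_imset.
have zf s : z s != 0 -> forall i, i \in s -> i \in codom f.
  by move=> /(chainsP _ _ _ zC) /andP [sK _] i; exact: Kf.
pose z' : chain J := [ffun s : {set J} => z (f @: s)].
exists z'.
  apply/cyclesP; split; last first.
    by apply/ffunP=> t; rewrite (bd_f z) ?z0 ?ffunE // => s; rewrite ffunE.
  apply/chainsP=> s; rewrite ffunE => /(chainsP _ _ _ zC) /andP [sK].
  by rewrite inE sK card_f.
apply: contra zB => /boundariesP [u uC zu]; apply/boundariesP.
(* Extension by zero to the sets that are not contained in the range of [f]. *)
pose v : chain I := [ffun s : {set I} =>
  if [forall i in s, i \in codom f] then u (f @^-1: s) else 0].
have vf s : v s != 0 -> forall i, i \in s -> i \in codom f.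
  by rewrite ffunE; case: ifP => [/forall_inP //|]; rewrite eqxx.
have uv s : u s = v (f @: s).
  rewrite ffunE fK; case: ifP => // /forall_inP [] i /imsetP [j _ ->].
  exact: codom_f.
exists v.
  apply/chainsP=> s vs; have sf := fsub _ (vf _ vs); move: vs; rewrite -{1}sf -uv.
  by move/(chainsP _ _ _ uC); rewrite inE sf -card_f sf.
apply/ffunP=> s.
have [/forall_inP sP|/forall_inPn [i is_ fi]] := boolP [forall i in s, i \in codom f].
  by rewrite -(fsub s sP) -(bd_f v u) // -zu ffunE.
rewrite bdE big1 => [|j _].
  by apply: contraNeq fi => /zf; apply.
by apply: contraNeq fi => /vf; apply; rewrite inE is_ orbT.
Qed.

(** * Covers by sets inside a prescribed vertex set *)

Lemma nerveP (T I : finType) (F : I -> {set T}) (s : {set I}) :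
  reflect (exists x, forall i, i \in s -> x \in F i) (s \in nerve F).
Proof.
rewrite inE; apply: (iffP (set0Pn _)) => -[x xP]; exists x.
  by move=> i; apply: (bigcapP xP).
by apply/bigcapP.
Qed.

(** A connected cover in [G] whose members lie in [S], where the index type is
    any finite type and members may be empty: an empty member is not a vertex of
    the nerve, so it does not affect the homology. *)
Definition weak_cover (G : sgraph) (S : {set G}) (I : finType)
    (F : I -> {set G}) : Prop :=
  (forall i, F i \subset S) /\
  forall s : {set I}, s != set0 -> s \in nerve F ->
    connected (induced (\bigcap_(i in s) F i)).

Lemma weak_cover_reindex (G : sgraph) (S : {set G}) (I : finType)
    (F : I -> {set G}) d :
  weak_cover S F -> homology_nonzero (nerve F) d ->
  exists n (F' : 'I_n -> {set G}),
    [/\ weak_cover S F', forall i, F' i != set0 & homology_nonzero (nerve F') d].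
Proof.
case=> FS cF hF; pose A := [set i | F i != set0].
pose f : 'I_#|A| -> I := @enum_val I (mem A).
have f_inj : injective f by exact: enum_val_inj.
have nf (s : {set 'I_#|A|}) : (s \in nerve (F \o f)) = (f @: s \in nerve F).
  apply/nerveP/nerveP => -[x xP]; exists x.
    by move=> i /imsetP [j js ->]; exact: xP.
  by move=> j js; apply: xP; exact: imset_f.
exists #|A|, (F \o f); split.
- split=> [i|s s0 sN]; first exact: FS.
  have -> : \bigcap_(i in s) (F \o f) i = \bigcap_(i in f @: s) F i.
    by rewrite big_imset // => i j _ _ /f_inj.
  apply: cF; last by rewrite -nf.
  by case/set0Pn: s0 => j js; apply/set0Pn; exists (f j); exact: imset_f.
- by move=> i; have := enum_valP i; rewrite inE.
have -> : nerve (F \o f) = [set s : {set 'I_#|A|} | f @: s \in nerve F].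
  by apply/setP=> s; rewrite [RHS]inE nf.
apply: homology_reindex => // s i /nerveP [x xP] is_.
have iA : i \in A by rewrite inE; apply/set0Pn; exists x; exact: xP.
by apply/codomP; exists (enum_rank_in iA i); rewrite /f enum_rankK_in.
Qed.

Lemma cover_homology_weak (G : sgraph) d :
  cover_homology G d <->
  exists (I : finType) (F : I -> {set G}),
    weak_cover setT F /\ homology_nonzero (nerve F) d.
Proof.
split=> [[n [F [[F0 cF] hF]]]|[I [F [cF /(weak_cover_reindex cF)]]]].
  by exists 'I_n, F; split=> //; split=> // i; exact: subsetT.
by case=> n [F' [[_ cF'] F0' hF']]; exists n, F'.
Qed.

(** [S] is non-empty so that the empty face lies in the nerve on both sides. *)
Lemma cover_homology_induced (G : sgraph) (S : {set G}) d : S != set0 ->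
  cover_homology (induced S) d <->
  exists (I : finType) (F : I -> {set G}),
    weak_cover S F /\ homology_nonzero (nerve F) d.
Proof.
move=> /set0Pn [x0 x0S].
have nE (I : finType) (F : I -> {set G}) (F' : I -> {set induced S}) :
    (forall i, F i \subset S) -> (forall i, F' i = val @^-1: F i) -> nerve F = nerve F'.
  move=> FS F'E; apply/setP=> s; apply/nerveP/nerveP => -[x xP].
    have [->|/set0Pn [i is_]] := eqVneq s set0.
      by exists (exist _ x0 x0S) => i; rewrite inE.
    exists (exist _ x (subsetP (FS i) x (xP i is_))) => j js.
    by rewrite F'E inE; exact: xP.
  by exists (val x) => i /xP; rewrite F'E inE.
have capE (I : finType) (F : I -> {set G}) (F' : I -> {set induced S}) (s : {set I}) :
    (forall i, F' i = val @^-1: F i) ->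
    \bigcap_(i in s) F' i = val @^-1: (\bigcap_(i in s) F i).
  move=> F'E; apply/setP=> x; rewrite inE.
  by apply/bigcapP/bigcapP => xP i /xP; rewrite F'E inE.
have capS (I : finType) (F : I -> {set G}) (s : {set I}) : s != set0 ->
    (forall i, F i \subset S) -> \bigcap_(i in s) F i \subset S.
  by case/set0Pn=> i is_ FS; apply: subset_trans (FS i); apply: bigcap_inf.
split=> [[n [F' [[F0 cF'] hF']]]|[I [F [cF hF]]]].
  pose F i := val @: F' i.
  have FS i : F i \subset S.
    by apply/subsetP=> _ /imsetP [x _ ->]; exact: valP.
  have F'E i : F' i = val @^-1: F i.
    by apply/setP=> x; rewrite inE (mem_imset _ _ val_inj).
  exists 'I_n, F; rewrite (nE _ F F') //; split=> //; split=> // s s0 sN.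
  apply/(connected_preim_val (capS _ _ _ s0 FS)); rewrite -(capE _ F F') //.
  by apply: cF' => //; rewrite -(nE _ F F').
have [n [F1 [[FS cF1] F0 hF1]]] := weak_cover_reindex cF hF.
pose F' i : {set induced S} := val @^-1: F1 i.
exists n, F'; rewrite -(nE _ F1 F') //; split=> //; split=> [i|s s0 sN].
  have /set0Pn [x xF] := F0 i.
  by apply/set0Pn; exists (exist _ x (subsetP (FS i) x xF)); rewrite inE.
rewrite (capE _ F1) //; apply/(connected_preim_val (capS _ _ _ s0 FS)).
by apply: cF1 => //; rewrite (nE _ F1 F').
Qed.

Lemma weak_coverS (G : sgraph) (S T : {set G}) (I : finType) (F : I -> {set G}) :
  S \subset T -> weak_cover S F -> weak_cover T F.
Proof.
by move=> ST [FS cF]; split=> // i; exact: subset_trans (FS i) ST.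
Qed.

Lemma cover_homology_setT (G : sgraph) (S : {set G}) d :
  S != set0 -> cover_homology (induced S) d -> cover_homology G d.
Proof.
move=> S0 /(cover_homology_induced _ S0) [I [F [/(weak_coverS (subsetT S)) cF hF]]].
by apply/cover_homology_weak; exists I, F.
Qed.

(** * A Mayer-Vietoris argument *)

(** The part of the Mayer-Vietoris sequence around the connecting map: a class of
    the union that does not come from the two pieces has a non-zero image in the
    homology of the intersection, represented by the boundary of [a]. *)
Lemma homology_union (T I : finType) (F1 F2 : I -> {set T}) d :
  homology_nonzero (nerve F1 :|: nerve F2) d ->
  [\/ homology_nonzero (nerve F1) d, homology_nonzero (nerve F2) d |
   exists a, [/\ a \in chains (nerve F1) d,
                 bd I a \in chains (nerve F1 :&: nerve F2) (d - 1) &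
                 bd I a \notin boundaries (nerve F1 :&: nerve F2) (d - 1)]].
Proof.
case/homology_nonzeroE=> z /cyclesP [zC z0] zB.
have [h1|h1] := pselect (homology_nonzero (nerve F1) d); first by constructor 1.
have [h2|h2] := pselect (homology_nonzero (nerve F2) d); first by constructor 2.
constructor 3.
have cycB (K : {set {set I}}) c : ~ homology_nonzero K d -> c \in cycles K d -> c \in boundaries K d.
  move=> hK cK; apply/negPn/negP => cB; apply: hK.
  by apply/homology_nonzeroE; exists c.
(* [z] is cut into [a], on the faces of the first nerve, and the rest [b]. *)
pose a : chain I := [ffun s : {set I} => if s \in nerve F1 then z s else 0].
pose b := z - a.
have aC : a \in chains (nerve F1) d.
  apply/chainsP=> s; rewrite ffunE; case: ifP => [_|]; last by rewrite eqxx.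
  by case/(chainsP _ _ _ zC)/andP.
have bC : b \in chains (nerve F2) d.
  apply/chainsP=> s; rewrite !ffunE; case: ifP => s1; rewrite ?subrr ?eqxx //.
  by rewrite subr0 => /(chainsP _ _ _ zC); rewrite inE s1.
have ab : bd I b = - bd I a by rewrite linearB /= z0 sub0r.
have dC (F : I -> {set T}) c : c \in chains (nerve F) d -> bd I c \in chains (nerve F) (d - 1).
  by move=> cC; apply: bd_chains; rewrite subrK.
have aC1 := dC _ _ aC; have := dC _ _ bC; rewrite ab rpredN => aC2.
exists a; split=> //.
  apply/chainsP=> s sa; rewrite inE.
  by case/andP: (chainsP _ _ _ aC1 s sa) => -> ->; case/andP: (chainsP _ _ _ aC2 s sa) => ->.
apply: contra zB => /boundariesP [u]; rewrite subrK => uC au.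
have uC1 := subvP (chainsS _ (subsetIl _ _)) _ uC.
have uC2 := subvP (chainsS _ (subsetIr _ _)) _ uC.
(* Correcting by a chain of the intersection turns both halves into cycles. *)
have -> : z = (a - u) + (b + u) by rewrite addrACA addNr addr0 addrC subrK.
apply: rpredD.
  apply: (subvP (boundariesS _ (subsetUl _ _))); apply: cycB => //.
  by apply/cyclesP; split; [exact: rpredB | rewrite linearB /= au subrr].
apply: (subvP (boundariesS _ (subsetUr _ _))); apply: cycB => //.
by apply/cyclesP; split; [exact: rpredD | rewrite linearD /= ab au addNr].
Qed.

(** [K] is seen as the complex [K0] on [I] together with a cone, with apex [None],
    over the complex [L]. A chain of [K0] whose boundary is a non-bounding chain of
    [L] is completed to a cycle of [K] by the cone over that boundary. *)
Lemma homology_cone (I : finType) (K : {set {set option I}}) (a : chain I) d :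
  let K0 := [set s : {set I} | Some @: s \in K] in
  let L := [set s : {set I} | None |: Some @: s \in K] in
  a \in chains K0 d -> bd I a \in chains L (d - 1) ->
  bd I a \notin boundaries L (d - 1) -> homology_nonzero K d.
Proof.
move=> K0 L aC cC cB; apply/homology_nonzeroE.
have S_inj : injective (@Some I) by move=> i j [].
have NS (s : {set I}) : None \notin Some @: s by apply/imsetP => -[].
have SK (s : {set I}) : Some @^-1: (Some @: s) = s.
  by apply/setP=> i; rewrite inE (mem_imset _ _ S_inj).
have SNK (s : {set I}) : Some @^-1: (None |: Some @: s) = s.
  by apply/setP=> i; rewrite !inE /= (mem_imset _ _ S_inj).
have optE (s : {set option I}) :
    s = if None \in s then None |: Some @: (Some @^-1: s) else Some @: (Some @^-1: s).
  apply/setP=> -[i|]; case: ifP => sN; rewrite ?inE /= ?(mem_imset _ _ S_inj) ?inE //.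
  by rewrite (negPf (NS _)).
have bdN (c : chain (option I)) (s : {set I}) :
    bd _ c (None |: Some @: s) = \sum_(i | i \notin s) c (None |: Some @: (i |: s)).
  rewrite bdE (reindex_omap Some id) /=; last by case=> //; rewrite setU11.
  apply: eq_big => [i|i _]; first by rewrite !inE /= (mem_imset _ _ S_inj) eqxx andbT.
  by rewrite imsetU1 setUCA.
have bdS (c : chain (option I)) (s : {set I}) :
    bd _ c (Some @: s) = c (None |: Some @: s) + \sum_(i | i \notin s) c (Some @: (i |: s)).
  rewrite bdE (bigD1 None) ?NS //=; congr (_ + _).
  rewrite (reindex_omap Some id) /=; last by case=> //; rewrite andbF.
  apply: eq_big => [i|i _]; last by rewrite imsetU1.
  by rewrite (mem_imset _ _ S_inj) eqxx !andbT.
pose g : chain (option I) := [ffun s : {set option I} =>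
  if None \in s then bd I a (Some @^-1: s) else a (Some @^-1: s)].
have gN (s : {set I}) : g (None |: Some @: s) = bd I a s by rewrite ffunE setU11 SNK.
have gS (s : {set I}) : g (Some @: s) = a s by rewrite ffunE (negPf (NS _)) SK.
exists g.
  apply/cyclesP; split.
    apply/chainsP=> s; rewrite (optE s); case: ifP => _.
      rewrite gN => /(chainsP _ _ _ cC); rewrite inE subrK => /andP [-> /eqP <-].
      by rewrite cardsU1 NS card_imset //= PoszD addrC.
    by rewrite gS => /(chainsP _ _ _ aC); rewrite inE card_imset.
  apply/ffunP=> s; rewrite (optE s) ffunE; case: ifP => _.
    rewrite bdN (eq_bigr (fun i => bd I a (i |: Some @^-1: s))) => [|i _]; last exact: gN.
    by rewrite -bdE bd_bd ffunE.
  rewrite bdS gN (eq_bigr (fun i => a (i |: Some @^-1: s))) => [|i _]; last exact: gS.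
  by rewrite -bdE addF2.
apply: contra cB => /boundariesP [u uC gu]; apply/boundariesP; rewrite subrK.
(* If [g] is the boundary of [u], then [bd I a], the link of [g] at the apex, is
   the boundary of the link of [u]. *)
exists [ffun s : {set I} => u (None |: Some @: s)].
  apply/chainsP=> s; rewrite ffunE => /(chainsP _ _ _ uC); rewrite inE => /andP [-> /=].
  by rewrite cardsU1 NS card_imset //= PoszD addrC => /eqP/addIr ->.
apply/ffunP=> s; rewrite -gN gu bdN bdE.
by apply: eq_bigr => i _; rewrite ffunE.
Qed.

(** * Restricting a cover to the two sides of a clique-sum *)

Lemma bigcap_restrict (T I : finType) (F : I -> {set T}) (V : {set T}) (s : {set I}) :
  s != set0 -> \bigcap_(i in s) (F i :&: V) = (\bigcap_(i in s) F i) :&: V.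
Proof.
case/set0Pn=> i is_; apply/setP=> x; rewrite inE.
apply/bigcapP/andP => [xP|[/bigcapP xP xV] j js]; last by rewrite inE xP.
split; last by have := xP i is_; rewrite inE => /andP [].
by apply/bigcapP=> j /xP; rewrite inE => /andP [].
Qed.

Lemma weak_cover_restrict (G : sgraph) (V1 V2 : {set G}) (I : finType)
    (F : I -> {set G}) :
  clique_sum V1 V2 -> weak_cover setT F -> weak_cover V1 (fun i => F i :&: V1).
Proof.
move=> VG [_ cF]; split=> [i|s s0]; first exact: subsetIr.
rewrite inE bigcap_restrict // => sV.
apply: (connected_restrict VG) => //; apply: cF => //.
by rewrite inE; apply: contraNneq sV => ->; rewrite set0I.
Qed.

(** The family [F] with the additional member [C], indexed by [None]. *)
Definition adjoin (T I : finType) (F : I -> {set T}) (C : {set T}) :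
  option I -> {set T} := oapp F C.

Lemma weak_cover_adjoin (G : sgraph) (S C : {set G}) (I : finType)
    (F : I -> {set G}) :
  C \subset S ->
  (forall X : {set G}, X != set0 -> X \subset C -> connected (induced X)) ->
  weak_cover S F -> weak_cover S (adjoin F C).
Proof.
move=> CS cC [FS cF]; split=> [[i|] //|s s0 sN]; first exact: FS.
have [Ns|Ns] := boolP (None \in s).
  apply: cC; first by rewrite inE in sN.
  exact: (bigcap_inf None).
pose t := Some @^-1: s.
have sE : s = Some @: t.
  apply/setP=> -[i|]; first by rewrite mem_imset ?inE // => ? ? [].
  by rewrite (negPf Ns); apply/esym/negbTE/imsetP => -[].
have capE : \bigcap_(o in s) adjoin F C o = \bigcap_(i in t) F i.
  by rewrite sE big_imset // => ? ? _ _ [].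
rewrite capE; apply: cF; last by move: sN; rewrite !inE capE.
by apply: contraNneq s0 => t0; rewrite sE t0 imset0.
Qed.

(** The non-trivial half of the theorem, one degree at a time. *)
Lemma cover_homology_clique_sum (G : sgraph) (V1 V2 : {set G}) d :
  clique_sum V1 V2 -> cover_homology G d ->
  cover_homology (induced V1) d \/ cover_homology (induced V2) d.
Proof.
move=> VG /cover_homology_weak [I [F [cF hF]]].
have VG' := clique_sumC VG.
have [x0 /setIP [x01 x02]] : exists x, x \in V1 :&: V2.
  by case: VG => _ /set0Pn.
have V10 : V1 != set0 by apply/set0Pn; exists x0.
have V20 : V2 != set0 by apply/set0Pn; exists x0.
pose F1 i := F i :&: V1; pose F2 i := F i :&: V2.
have cF1 : weak_cover V1 F1 by exact: weak_cover_restrict VG cF.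
have cF2 : weak_cover V2 F2 by exact: weak_cover_restrict VG' cF.
have nU : nerve F = nerve F1 :|: nerve F2.
  apply/setP=> s; rewrite in_setU; apply/nerveP/orP.
    case=> x xP; case/orP: (clique_sum_mem VG x) => xV; [left|right];
    by apply/nerveP; exists x => i /xP; rewrite inE xV => ->.
  by case=> /nerveP [x xP]; exists x => i /xP; rewrite inE => /andP [].
rewrite nU in hF; case: (homology_union hF) => [h1|h2|[a [aC cC cB]]].
- by left; apply/(cover_homology_induced _ V10); exists I, F1.
- by right; apply/(cover_homology_induced _ V20); exists I, F2.
left; apply/(cover_homology_induced _ V10).
exists (option I), (adjoin F1 (V1 :&: V2)); split.
  apply: weak_cover_adjoin cF1; first exact: subsetIl.
  by move=> X X0 XC; exact: connected_subclique VG _ X0 XC.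
have n1 : nerve F1 = [set s : {set I} | Some @: s \in nerve (adjoin F1 (V1 :&: V2))].
  apply/setP=> s; rewrite [RHS]inE; apply/nerveP/nerveP => -[x xP]; exists x.
    by move=> _ /imsetP [i is_ ->]; exact: xP.
  by move=> i is_; apply: (xP (Some i)); exact: imset_f.
(* The link of the new member is the intersection of the two nerves: a face of
   both has a connected intersection that meets both sides, hence the clique. *)
have n12 : nerve F1 :&: nerve F2 =
    [set s : {set I} | None |: Some @: s \in nerve (adjoin F1 (V1 :&: V2))].
  apply/setP=> s; rewrite in_setI [RHS]inE; apply/andP/nerveP; last first.
    case=> x xP; have /setIP [x1 x2] := xP None (setU11 _ _).
    have xF i : i \in s -> x \in F i.
      move=> is_; have /setIP [] // : x \in F1 i.
      by apply: (xP (Some i)); rewrite !inE /= imset_f.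
    by split; apply/nerveP; exists x => i /xF; rewrite inE ?x1 ?x2 => ->.
  have [->|s0] := eqVneq s set0.
    by exists x0 => o; rewrite imset0 setU0 inE => /eqP ->; rewrite inE x01.
  rewrite !inE !bigcap_restrict // => -[s1 s2].
  have sc : connected (induced (\bigcap_(i in s) F i)).
    by apply: (proj2 cF) => //; rewrite inE; apply: contraNneq s1 => ->; rewrite set0I.
  have /set0Pn [x /setIP [/bigcapP xF xC]] := connected_meets_clique VG sc s1 s2.
  exists x => o; rewrite !inE => /orP [/eqP -> //|/imsetP [i is_ ->]].
  by rewrite /= inE xF //; case/setIP: xC.
by apply: (homology_cone (a := a)); rewrite -?n1 -?n12.
Qed.

(** * The homological dimension *)

Lemma cover_homology_hdim (G : sgraph) d :
  (1 < #|G|)%N -> cover_homology G d -> d <= hdim G.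
Proof. by move/hdimP=> [_ hG]; exact: hG. Qed.

Lemma hdim_geN1 (G : sgraph) : (0 < #|G|)%N -> -1 <= hdim G.
Proof.
rewrite leq_eqVlt => /orP [G1|G1]; first by rewrite /hdim eq_sym G1.
by apply: cover_homology_hdim => //; apply: cover_homologyN1; exact: ltnW.
Qed.

Lemma hdim_unique (G : sgraph) d :
  (1 < #|G|)%N -> greatest_cover_homology G d -> hdim G = d.
Proof.
move=> G1 [hd maxd]; have [hG maxG] := hdimP G1.
by apply/le_anti; rewrite maxd // maxG.
Qed.

Lemma card_induced (G : sgraph) (S : {set G}) : #|induced S| = #|S|.
Proof. by rewrite card_sig; apply: eq_card. Qed.

Lemma hdim_setT (G : sgraph) (S : {set G}) : S = setT -> (0 < #|G|)%N ->
  hdim G = hdim (induced S).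
Proof.
move=> ST G0; have cS : #|induced S| = #|G| by rewrite card_induced ST cardsT.
have S0 : S != set0 by rewrite -card_gt0 -card_induced cS.
have [G1|G1] := leqP #|G| 1.
  by rewrite /hdim cS eqn_leq G1 G0.
have [hS maxS] := @hdimP (induced S) (eq_ind_r (fun n => 1 < n)%N G1 cS).
apply: hdim_unique => //; split=> [|d /cover_homology_weak hd].
  exact: cover_homology_setT hS.
by apply: maxS; apply/(cover_homology_induced _ S0); rewrite ST.
Qed.

(** A single vertex [V1] is contained in [V2], which is then everything. *)
Lemma hdim_clique_sum1 (G : sgraph) (V1 V2 : {set G}) :
  clique_sum V1 V2 -> #|V1| = 1%N ->
  hdim G = Order.max (hdim (induced V1)) (hdim (induced V2)).
Proof.
case=> VU /set0Pn [x0 /setIP [x1 x2]] _ _ V1c.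
have V12 : V1 \subset V2.
  have /eqP/cards1P [y yE] := V1c; move: x1; rewrite yE inE => /eqP <-.
  by rewrite sub1set.
have V2T : V2 = setT by rewrite -VU; apply/esym/setUidPr.
have G0 : (0 < #|G|)%N by apply/card_gt0P; exists x0.
rewrite (hdim_setT V2T G0) [hdim (induced V1)]/hdim card_induced V1c eqxx.
by apply/esym/max_r/hdim_geN1; rewrite card_induced V2T cardsT.
Qed.

Theorem theorem2p5 (G : sgraph) (V1 V2 : {set G}) :
  clique_sum V1 V2 ->
  hdim G = Order.max (hdim (induced V1)) (hdim (induced V2)).
Proof.
move=> VG; have [x0 /setIP [x1 x2]] : exists x, x \in V1 :&: V2.
  by case: VG => _ /set0Pn.
have V10 : V1 != set0 by apply/set0Pn; exists x0.
have V20 : V2 != set0 by apply/set0Pn; exists x0.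
have [V1le|V1gt] := leqP #|V1| 1.
  by apply: hdim_clique_sum1 => //; apply/eqP; rewrite eqn_leq V1le card_gt0.
have [V2le|V2gt] := leqP #|V2| 1.
  rewrite maxC; apply: hdim_clique_sum1 (clique_sumC VG) _.
  by apply/eqP; rewrite eqn_leq V2le card_gt0.
have G1 : (1 < #|G|)%N by apply: leq_trans V1gt (max_card _).
have I1 : (1 < #|induced V1|)%N by rewrite card_induced.
have I2 : (1 < #|induced V2|)%N by rewrite card_induced.
apply: hdim_unique => //; split=> [|d].
  rewrite maxEle; case: ifP => _.
    exact: cover_homology_setT V20 (proj1 (hdimP I2)).
  exact: cover_homology_setT V10 (proj1 (hdimP I1)).
case/(cover_homology_clique_sum VG) => /cover_homology_hdim hd.
  by rewrite le_max hd.
by rewrite le_max hd ?orbT.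
Qed.
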